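(* Let $q$ be a prime power, let $m,n,\ell,s\ge 0$ be integers, and let $$Q=m[0,e_1]+n[0,e_2]+\ell[0,e_1+e_2]+s[0,e_1-e_2]+2\ell\Delta,$$ where $s e_2+Q\subseteq[0,q-2]^2$. Assume that $0\le n+2\ell\le m+2\ell\le s$ and that there is an integer $t$ with $m+2\ell\le t\le s$ such that $t\mid q-1$. Then $$d(C_Q)=(q-1)^2-L(Q)(q-1)+s(m+n+4\ell)$$ whenever $q-1-M\sqrt{q}>s(2\ell+m)+s(2\ell+n)+(2\ell+m)(2\ell+n)$, where $M=\max\{2\operatorname{Area}(Q)-1,\,6\}$.
   Context: $e_1,e_2$ are the standard basis vectors of $\mathbb{R}^2$, $[0,v]$ is the segment from $0$ to $v$, $\Delta=\operatorname{conv}\{(0,0),(1,0),(0,1)\}$, sums of polytopes are Minkowski sums, and $kA=\{ka:a\in A\}$. A lattice polytope is the convex hull of a nonempty finite subset of $\mathbb{Z}^2$. The Minkowski length $L(Q)$ is the maximum number of non-trivial (at least one-dimensional) lattice polytopes whose Minkowski sum is contained in $Q$. $\operatorname{Area}$ is Euclidean area. For a lattice polytope $Q\subset\mathbb{R}^2$, $\mathcal{L}_Q=\operatorname{span}_{\mathbb{F}_q}\{t^\alpha:\alpha\in Q\cap\mathbb{Z}^2\}\subset\mathbb{F}_q[t_1^{\pm1},t_2^{\pm1}]$, and the toric code $C_Q\subseteq\mathbb{F}_q^{(q-1)^2}$ is the image of the evaluation map $f\mapsto(f(\gamma))_{\gamma\in(\mathbb{F}_q^\times)^2}$ on $\mathcal{L}_Q$.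 The minimum distance $d(C)$ of a linear code $C$ is the minimum number of nonzero entries of a nonzero element of $C$. *)

(* Defs.v *)
From HB Require Import structures.
From mathcomp Require Import all_boot all_order all_algebra finmap.
From mathcomp Require Import all_classical all_reals all_analysis.

Set Implicit Arguments.
Unset Strict Implicit.
Unset Printing Implicit Defensive.

Import Order.TTheory GRing.Theory Num.Theory.
Import numFieldNormedType.Exports.

Local Open Scope classical_set_scope.
Local Open Scope ring_scope.

(* [R^o] is [R] seen as a module over itself, so that [plane R] is an [lmodType]
   and [convex_set] applies. *)
Notation plane R := (R^o * R^o)%type.

Section Plane.
Variable R : realType.

Definition convex_hull (A : set (plane R)) : set (plane R) :=
  smallest (@convex_set R (plane R)) A.

Definition segment0 (v : plane R) : set (plane R) := convex_hull [set 0; v].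

Definition std_simplex : set (plane R) :=
  convex_hull ((0, 0) |` ((1, 0) |` [set (0, 1)])).

Definition minkowski_add (A B : set (plane R)) : set (plane R) :=
  [set x + y | x in A & y in B].

Definition dilate (k : nat) (A : set (plane R)) : set (plane R) :=
  [set a *+ k | a in A].

Definition lattice_point (a : int * int) : plane R := (a.1%:~R, a.2%:~R).

Definition lattice_polytope (P : set (plane R)) : Prop :=
  exists A : set (int * int),
    [/\ finite_set A, A !=set0 & P = convex_hull (lattice_point @` A)].

Definition nontrivial (P : set (plane R)) : Prop :=
  exists x y, [/\ P x, P y & x <> y].

Definition contains_minkowski_sum (Q : set (plane R)) (k : nat) : Prop :=
  exists P : 'I_k -> set (plane R),
    (forall i, lattice_polytope (P i) /\ nontrivial (P i)) /\
    \big[minkowski_add/[set 0]]_(i < k) P i `<=` Q.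

Definition area (Q : set (plane R)) : R :=
  fine ((@lebesgue_measure R \x @lebesgue_measure R)%E Q).

End Plane.

Arguments std_simplex R : clear implicits.
Arguments lattice_point R a : clear implicits.

(* The largest (resp. smallest) element of a set of naturals, and the junk
   value 0 when there is none. *)
Definition maximum (A : set nat) : nat := xget 0%N (A `&` ubound A).
Definition minimum (A : set nat) : nat := xget 0%N (A `&` lbound A).

(* The empty sum is [set 0], so a lattice point other than the origin admits no
   [k] at all; the junk value of [maximum] is then the expected length 0. *)
Definition minkowski_length (R : realType) (Q : set (plane R)) : nat :=
  maximum [set k | contains_minkowski_sum Q k].

Section ToricCode.
Variable F : finFieldType.

(* A Laurent polynomial in two variables is its finitely supported family of
   coefficients, indexed by exponent vectors. *)
Definition laurent : Type := {fsfun int * int -> F with 0}.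

Definition laurent_monomial (a : int * int) : laurent :=
  [fsfun b in [fset a]%fset => 1].

Definition laurent_eval (f : laurent) (g : {unit F} * {unit F}) : F :=
  \sum_(a <- finsupp f) f a * (val g.1 ^ a.1 * val g.2 ^ a.2).

(* The linear span of the monomials with exponents in [Q], with sums of Laurent
   polynomials computed coefficientwise. *)
Definition laurent_space (R : realType) (Q : set (plane R)) : set laurent :=
  [set f | exists (r : seq (int * int)) (c : int * int -> F),
    (forall a, a \in r -> Q (lattice_point R a)) /\
    (forall b, f b = \sum_(a <- r) c a * laurent_monomial a b)].

Definition toric_code (R : realType) (Q : set (plane R)) :
    set {ffun {unit F} * {unit F} -> F} :=
  [set [ffun g => laurent_eval f g] | f in laurent_space Q].

End ToricCode.

Arguments toric_code F {R} Q.

Definition hamming_weight (F : fieldType) (I : finType) (c : {ffun I -> F}) :=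
  #|[pred i | c i != 0]|.

Definition min_distance (F : fieldType) (I : finType)
    (C : set {ffun I -> F}) : nat :=
  minimum [set hamming_weight c | c in [set c | C c /\ c <> 0]].

(* Main.v *)
Require Import Defs.
From HB Require Import structures.
From mathcomp Require Import all_boot all_order all_algebra finmap.
From mathcomp Require Import all_fingroup all_solvable.
From mathcomp Require Import zify ring lra.

Set Implicit Arguments.
Unset Strict Implicit.
Unset Printing Implicit Defensive.

Import Order.TTheory GRing.Theory Num.Theory.

Local Open Scope ring_scope.

(** Write a = m + 2l, b = n + 2l and N = q - 1, and let e1, e2 be the basis
    vectors.  The claim reads d = N^2 - L(Q) N + s (a + b), and the proof is
    elementary: it counts points on the lines of three pencils in the torus.

    The Minkowski length is L(Q) = s + a + b.  The polygon Q contains the sum of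
    s copies of [0, e1 - e2], a copies of [0, e1] and b copies of [0, e2]
    (toric_polygon_mem).  Conversely the functional
        P |-> max (x + y) - min x - min y
    is additive under Minkowski sums, is at least 1 on a nontrivial lattice
    polytope, and is s + a + b on Q (minkowski_count_bound).

    For the upper bound on d, take sets A, B, C of a, b, s units such that
    x / y lies in C for all x in A and y in B; these come from a subgroup of
    order t, with A and B inside it and C around it.  In the polynomial
        prod (x - alpha) prod (y - beta) prod (x / y - gamma)
    each of the a b crossings of the first two families of lines lies on a line
    of the third, and inclusion-exclusion gives L(Q) N - s (a + b) zeros
    (card_off_concurrent_lines).

    For the lower bound, let f be nonzero with exponents in Q, put G = y^s f,
    and let k1, k2, k3 count the lines x = alpha, y = beta, x = gamma y on which
    G vanishes identically.  Three cases suffice (torus_zeros_bound).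
    - If k3 <= s: on any other line x = gamma y there are at most a + b zeros,
      so G has at most k3 N + (N - k3)(a + b) zeros, which is largest for
      k3 = s, where it equals L(Q) N - s (a + b).
    - If k2 < b: on any other line y = beta there are at most deg_x G zeros.
      The leading coefficient of G in x is a polynomial in y with k2 roots, and
      the shape of Q bounds its length, which yields
      2 deg_x G + k2 <= 2 (s + a) + b and so k2 + deg_x G <= L(Q) - 1.  Hence G
      has at most (L(Q) - 1) N zeros, and N >= s (a + b) by the hypothesis
      on q.  The case k1 < a is symmetric.
    - Otherwise k1 + k2 + k3 > L(Q).  But G has total degree at most L(Q), and
      it is divisible by k1 + k2 + k3 coprime polynomials of degree 1, which is
      impossible. *)

(** * Polynomials in two variables restricted to the lines of a pencil *)

Section Curves.
Variable F : finFieldType.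
Local Notation U := {unit F}.

Lemma unit_val_neq0 (u : U) : val u != 0.
Proof. by have := valP u; rewrite unitfE. Qed.

(** A factor 'X^lo has no roots among the units, so only the length of the
    support of p counts. *)
Lemma unit_roots_bound (p : {poly F}) lo :
  p != 0 -> (forall i, (i < lo)%N -> p`_i = 0) ->
  (#|[pred u : U | root p (val u)]| + lo < size p)%N.
Proof.
move=> p0 plo; pose r := drop_poly lo p.
have pE : p = r * 'X^lo.
  rewrite -[LHS](poly_take_drop lo) (_ : take_poly lo p = 0) ?add0r //.
  by apply/polyP => i; rewrite coef_take_poly coef0; case: ifP => // /plo.
have r0 : r != 0 by apply: contraNneq p0 => r0; rewrite pE r0 mul0r.
have -> : size p = (size r + lo)%N by rewrite {1}pE size_mulXn // addnC.
rewrite ltn_add2r cardE -(size_map (val : U -> F)).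
apply: max_poly_roots => //; last first.
  by rewrite map_inj_uniq ?enum_uniq //; exact: val_inj.
apply/allP => _ /mapP[u pu ->].
move: pu; rewrite mem_enum inE pE rootM => /orP[//|].
by rewrite /root hornerXn expf_eq0 (negPf (unit_val_neq0 u)) andbF.
Qed.

(** The inner variable of p is the parameter of a line and the outer variable
    the position on it; a null fibre is a line on which p vanishes as a
    polynomial, which is stronger than vanishing at each of its unit points. *)
Definition null_fibres (p : {poly {poly F}}) : pred U :=
  [pred u | map_poly (horner_eval (val u)) p == 0].

(** A null fibre has at most #|U| zeros, any other one at most w, the length of
    the support of p in the outer variable. *)
Lemma fibre_zeros_bound (p : {poly {poly F}}) lo w :
  (forall i, (i < lo)%N -> p`_i = 0) -> (size p <= lo + w.+1)%N ->
  (#|[pred z : U * U | p.[(val z.2)%:P].[val z.1] == 0%R]|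
    <= #|null_fibres p| * #|{: U}| + (#|{: U}| - #|null_fibres p|) * w)%N.
Proof.
move=> plo pw.
rewrite -sum1_card big_mkcond /=.
rewrite -(pair_big xpredT xpredT
  (fun u t : U => if p.[(val t)%:P].[val u] == 0%R then 1 else 0)%N) /=.
apply: (@leq_trans (\sum_(u : U) if null_fibres p u then #|{: U}| else w)).
  apply: leq_sum => u _; rewrite -big_mkcond sum1_card.
  case: ifPn => [_|nu]; first exact: max_card.
  set pu := map_poly (horner_eval (val u)) p in nu.
  rewrite (eq_card (B := [pred t : U | root pu (val t)])); last first.
    move=> t; rewrite !inE /root; congr (_ == _).
    by rewrite -[LHS]/(horner_eval (val u) _) -horner_map /= horner_evalE hornerC.
  have /(unit_roots_bound nu) : forall i, (i < lo)%N -> pu`_i = 0.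
    by move=> i /plo pi0; rewrite coef_map pi0 /= horner_evalE horner0.
  have := leq_trans (size_poly _ _ : (size pu <= size p)%N) pw.
  rewrite -ltnS => pu_size bound; move: (leq_trans bound pu_size).
  by rewrite addnC ltn_add2l ltnS.
rewrite (bigID (null_fibres p)) /=.
rewrite (eq_bigr (fun=> #|{: U}|)) => [|u ->//].
rewrite [X in (_ + X)%N](eq_bigr (fun=> w)) => [|u /negPf->//].
rewrite !sum_nat_const leq_add2l leq_mul2r.
by rewrite -(cardC (null_fibres p)) addKn leqnn orbT.
Qed.

Section Bivariate.
(** One family of coefficients c is read in several coordinate systems: T
    indexes the monomials and each pair of exponent functions on T gives a
    polynomial in {poly {poly F}}. *)
Variables (T : finType) (c : T -> F).

Definition bipoly (e e' : T -> nat) : {poly {poly F}} :=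
  \sum_a (c a *: 'X^(e' a))%:P * 'X^(e a).

Lemma bipoly_coef e e' i :
  (bipoly e e')`_i = \sum_(a | e a == i) c a *: 'X^(e' a).
Proof.
rewrite /bipoly coef_sum [RHS]big_mkcond; apply: eq_bigr => a _.
by rewrite coefCM coefXn eq_sym; case: eqP; rewrite ?mulr1 ?mulr0.
Qed.

Lemma horner_bipoly e e' x :
  (bipoly e e').[x] = \sum_a c a *: 'X^(e' a) * x ^+ e a.
Proof.
by rewrite horner_sum; apply: eq_bigr => a _; rewrite hornerM hornerC hornerXn.
Qed.

Lemma horner2_bipoly e e' x y :
  (bipoly e e').[x%:P].[y] = \sum_a c a * (x ^+ e a * y ^+ e' a).
Proof.
rewrite horner_bipoly horner_sum; apply: eq_bigr => a _.
by rewrite -polyC_exp hornerM hornerZ hornerXn hornerC -mulrA [y ^+ _ * _]mulrC.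
Qed.

Lemma bipoly_fibre e e' u :
  map_poly (horner_eval u) (bipoly e e') =
    \sum_a (c a * u ^+ e' a) *: 'X^(e a).
Proof.
rewrite rmorph_sum; apply: eq_bigr => a _ /=.
rewrite rmorphM /= map_polyC map_polyXn /= horner_evalE hornerZ hornerXn.
by rewrite mul_polyC.
Qed.

Lemma size_bipoly e e' K :
  (forall a, (e a < K)%N) -> (size (bipoly e e') <= K)%N.
Proof.
move=> eK; apply/leq_sizeP => i Ki; rewrite bipoly_coef big_pred0 // => a.
by apply/negbTE/eqP => ea; have := eK a; rewrite ea ltnNge Ki.
Qed.

(** The leading coefficient in the outer variable, of degree d, vanishes at every
    null fibre, while its support lies in [d - D, L - d]. *)
Lemma bipoly_fibres_bound e e' L D :
  bipoly e e' != 0 ->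
  (forall a, (e a + e' a <= L)%N) -> (forall a, (e a <= e' a + D)%N) ->
  (#|null_fibres (bipoly e e')| + ((size (bipoly e e')).-1 - D)
    + (size (bipoly e e')).-1 <= L)%N.
Proof.
set p := bipoly e e'; set d := (size p).-1 => p0 eL eD.
set g := p`_d; have g0 : g != 0 by rewrite -[g]/(lead_coef p) lead_coef_eq0.
have gE : g = \sum_(a | e a == d) c a *: 'X^(e' a) by exact: bipoly_coef.
have glo i : (i < d - D)%N -> g`_i = 0.
  move=> id; rewrite gE coef_sum big1 // => a /eqP ead.
  rewrite coefZ coefXn; case: eqP => [ie|]; rewrite ?mulr0 //.
  by move: (eD a) id; rewrite ead ie; lia.
have [a0 /eqP ea0|noa] := pickP (fun a => e a == d); last first.
  by rewrite gE big_pred0 ?eqxx in g0.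
have gsize : (size g <= (L - d).+1)%N.
  apply/leq_sizeP => i Li; rewrite gE coef_sum big1 // => a /eqP ead.
  rewrite coefZ coefXn; case: eqP => [ie|]; rewrite ?mulr0 //.
  by move: (eL a) Li; rewrite ead ie; lia.
have Kg : (#|null_fibres p| <= #|[pred u : U | root g (val u)]|)%N.
  apply/subset_leq_card/subsetP => u; rewrite !inE => /eqP pu0.
  by rewrite /root -[g.[_]]/(horner_eval _ _) -coef_map pu0 coef0.
have := unit_roots_bound g0 glo.
have := eL a0; rewrite ea0.
set K1 := #|null_fibres p| in Kg *; set K2 := #|_| in Kg *.
move: (size g) gsize Kg => sg; lia.
Qed.

End Bivariate.

(** * The number of zeros in the torus *)

Section ZeroBound.
(** The exponents lie in the translate by (0, s) of a polygon of the shape of Q,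
    where m and n stand for the numbers m + 2l and n + 2l of the theorem. *)
Variables (T : finType) (c : T -> F) (e1 e2 : T -> nat) (s m n : nat).
Hypothesis e_ge : forall a, (s <= e1 a + e2 a)%N.
Hypothesis e_le : forall a, (e1 a + e2 a <= s + m + n)%N.
Hypothesis e1_le : forall a, (e1 a <= e2 a + (s + m))%N.
Hypothesis e2_le : forall a, (e2 a <= e1 a + (s + n))%N.

Let ev (z : U * U) := \sum_a c a * (val z.1 ^+ e1 a * val z.2 ^+ e2 a).
(* The null fibres of X are horizontal lines, those of Y vertical lines, and
   those of D, which is ev at (u t, t), lines x = u y through the origin. *)
Let X := bipoly c e1 e2.
Let Y := bipoly c e2 e1.
Let D := bipoly c (fun a => e1 a + e2 a)%N e1.

(** A polynomial of total degree at most s + m + n vanishes on at most s + m + n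
    lines.  The null fibres of Y and D provide distinct roots, alpha and u y, of X
    seen as a polynomial in x over the domain F[y], which bounds them by the
    degree in x; the leading coefficient leaves at most the rest of the total
    degree to the null fibres of X. *)
Lemma three_pencils_bound : X != 0 ->
  (#|null_fibres X| + #|null_fibres Y| + #|null_fibres D| <= s + m + n)%N.
Proof.
move=> X0.
pose rs := [seq (val u)%:P | u <- enum (null_fibres Y)]
        ++ [seq val u *: 'X | u <- enum (null_fibres D)].
have rs_root : all (root X) rs.
  rewrite all_cat; apply/andP; split; apply/allP => _ /mapP[u + ->];
    rewrite mem_enum inE => /eqP u0; rewrite /root horner_bipoly.
    rewrite -[X in _ == X]u0 bipoly_fibre; apply/eqP/eq_bigr => a _.
    by rewrite -polyC_exp -mul_polyC mulrAC -polyCM mul_polyC.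
  rewrite -[X in _ == X]u0 bipoly_fibre; apply/eqP/eq_bigr => a _.
  by rewrite exprZn -scalerAl -scalerAr -exprD scalerA addnC.
have rs_uniq : uniq rs.
  rewrite cat_uniq !map_inj_uniq ?enum_uniq ?andbT //=.
  - apply/hasPn => _ /mapP[u _ ->]; apply/mapP => -[v _].
    move=> /(congr1 (fun p : {poly F} => p`_1)).
    by rewrite coefZ coefX coefC mulr1 => /eqP; rewrite (negPf (unit_val_neq0 u)).
  - move=> u v /(congr1 (fun p : {poly F} => p`_1)).
    rewrite !coefZ !coefX !mulr1; exact: val_inj.
  - by move=> u v /polyC_inj/val_inj.
have := max_poly_roots X0 rs_root rs_uniq.
rewrite size_cat !size_map -!cardE.
have := bipoly_fibres_bound X0 e_le e1_le; rewrite -/X.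
move: (size X) #|null_fibres X| #|null_fibres Y| #|null_fibres D|.
by move=> sX kX kY kD; lia.
Qed.

Let card_inj (h : U * U -> U * U) (P : pred (U * U)) :
  injective h -> #|P| = #|[pred z | P (h z)]|.
Proof.
by move=> hI; rewrite -!sum1_card (reindex_inj hI); apply: eq_bigl => z.
Qed.

(** The bound is attained by suitable products of s, m and n lines of the three
    pencils, so the case of at most s null fibres of D has to be exact.  In the other
    cases a whole multiple of #|U| is saved. *)
Lemma torus_zeros_bound (z0 : U * U) :
  ev z0 != 0 -> (s * (m + n) <= #|{: U}|)%N ->
  (#|[pred z | ev z == 0%R]| + s * (m + n) <= (s + m + n) * #|{: U}|)%N.
Proof.
move=> ez0 swU; set Z := #|_|.
have XE (z : U * U) : X.[(val z.2)%:P].[val z.1] = ev (z.2, z.1).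
  by rewrite horner2_bipoly.
have YE (z : U * U) : Y.[(val z.2)%:P].[val z.1] = ev z.
  by rewrite horner2_bipoly; apply: eq_bigr => a _; rewrite [X in _ * X]mulrC.
have DE (z : U * U) : D.[(val z.2)%:P].[val z.1] = ev (z.1 * z.2, z.2)%g.
  rewrite horner2_bipoly; apply: eq_bigr => a _ /=.
  by rewrite exprMn exprD; ring.
have X0 : X != 0.
  apply: contraNneq ez0 => X0.
  by rewrite [z0]surjective_pairing -(XE (z0.2, z0.1)) X0 !horner0.
have Y0 : Y != 0.
  by apply: contraNneq ez0 => Y0; rewrite -YE Y0 !horner0.
have ZX : Z = #|[pred z : U * U | X.[(val z.2)%:P].[val z.1] == 0]|.
  rewrite /Z (card_inj (h := fun z => (z.2, z.1))) => [|[? ?] [? ?] [-> ->] //].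
  by apply: eq_card => z; rewrite !inE XE.
have ZY : Z = #|[pred z : U * U | Y.[(val z.2)%:P].[val z.1] == 0]|.
  by apply: eq_card => z; rewrite !inE YE.
have ZD : Z = #|[pred z : U * U | D.[(val z.2)%:P].[val z.1] == 0]|.
  rewrite /Z (card_inj (h := fun z => (z.1 * z.2, z.2)%g)).
    by apply: eq_card => z; rewrite !inE DE.
  move=> [x y] [x' y'] /eqP; rewrite xpair_eqE => /andP[/= + /eqP yy].
  by rewrite yy => /eqP/mulIg ->.
have boundX := fibre_zeros_bound (p := X) (lo := 0) (w := (size X).-1).
have boundY := fibre_zeros_bound (p := Y) (lo := 0) (w := (size Y).-1).
have boundD := fibre_zeros_bound (p := D) (lo := s) (w := (m + n)%N).
rewrite -ZX in boundX; rewrite -ZY in boundY; rewrite -ZD in boundD.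
clear ZX ZY ZD.
have {}boundX := boundX (fun _ => ltac:(by [])) (leqSpred _).
have {}boundY := boundY (fun _ => ltac:(by [])) (leqSpred _).
have {}boundD : (Z <= #|null_fibres D| * #|{: U}|
    + (#|{: U}| - #|null_fibres D|) * (m + n))%N.
  apply: boundD => [i si|].
    rewrite bipoly_coef big_pred0 // => a.
    by apply/negbTE/eqP => ea; have := e_ge a; rewrite ea leqNgt si.
  by apply: size_bipoly => a; have := e_le a; lia.
have degX := bipoly_fibres_bound X0 e_le e1_le.
have degY : (#|null_fibres Y| + ((size Y).-1 - (s + n)) + (size Y).-1
    <= s + m + n)%N.
  by apply: bipoly_fibres_bound Y0 _ e2_le => a; rewrite addnC.
have lines := three_pencils_bound X0.
have KXU : (#|null_fibres X| <= #|{: U}|)%N by exact: max_card.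
have KYU : (#|null_fibres Y| <= #|{: U}|)%N by exact: max_card.
have KDU : (#|null_fibres D| <= #|{: U}|)%N by exact: max_card.
move: (size X).-1 (size Y).-1 #|null_fibres X| #|null_fibres Y| #|null_fibres D|
  #|{: U}| Z boundX boundY boundD degX degY lines KXU KYU KDU swU.
move=> dX dY kX kY kD N Z0.
move=> boundX boundY boundD degX degY lines KXU KYU KDU swU.
have [kDs|kDs] := leqP kD s.
  (* kD N + (N - kD) (m + n) is nondecreasing in kD as soon as m + n <= N *)
  have [s0|s_gt0] := posnP s.
    move: kDs boundD; rewrite s0 leqn0 => /eqP ->.
    by rewrite !mul0n subn0 add0n addn0 mulnC.
  have wN : (m + n <= N)%N by apply: leq_trans swU; rewrite leq_pmull.
  apply: (leq_trans (leq_add boundD (leqnn _))).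
  have [r Nr] : exists r, N = (r + (m + n))%N.
    by exists (N - (m + n))%N; rewrite subnK.
  move: KDU; rewrite -[(s + m + n)%N]addnA Nr; move: (m + n)%N => w KDU.
  have : (kD * r <= s * r)%N by rewrite leq_mul2r kDs orbT.
  have := leq_mul KDU (leqnn w).
  by rewrite mulnBl !mulnDr !mulnDl; lia.
have few k d : (k <= N)%N -> (Z0 <= k * N + (N - k) * d)%N ->
    (k + d < s + m + n)%N -> (Z0 + s * (m + n) <= (s + m + n) * N)%N.
  move=> kN Zkd kd; apply: (leq_trans (leq_add Zkd swU)).
  have : ((N - k) * d <= N * d)%N by rewrite leq_mul2r leq_subr orbT.
  have : ((k + d).+1 * N <= (s + m + n) * N)%N by rewrite leq_mul2r kd orbT.
  by rewrite mulSn mulnDl [(N * d)%N]mulnC; lia.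
have [kYn|kYn] := ltnP kX n; first by apply: few KXU boundX _; lia.
have [kXm|kXm] := ltnP kY m; first by apply: few KYU boundY _; lia.
(* more than s, m and n lines in the three pencils contradict the degree *)
by lia.
Qed.

End ZeroBound.
End Curves.

(** * Three families of lines through common points *)

Lemma card_pairs (S T : finType) (P : S -> T -> bool) :
  #|[pred z : S * T | P z.1 z.2]| = (\sum_x \sum_y P x y)%N.
Proof.
rewrite pair_bigA /= -sum1_card big_mkcond; apply: eq_bigr => z _.
by rewrite inE; case: (P _ _).
Qed.

Lemma exists_set_between (T : finType) (A B : {set T}) k :
  A \subset B -> (#|A| <= k <= #|B|)%N ->
  exists C : {set T}, [/\ A \subset C, C \subset B & #|C| = k].
Proof.
move=> AB /andP[Ak kB].
pose r := take (k - #|A|) (enum (B :\: A)).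
have rP x : x \in r -> x \in B :\: A by move/mem_take; rewrite mem_enum.
exists (A :|: [set x in r]); split.
- exact: subsetUl.
- rewrite subUset AB; apply/subsetP => x; rewrite inE => /rP.
  by rewrite inE => /andP[].
- rewrite cardsU (_ : A :&: _ = set0) ?cards0 ?subn0; last first.
    apply/setP => x; rewrite !inE; apply/negP => /andP[xA /rP].
    by rewrite !inE xA.
  rewrite cardsE (card_uniqP _) ?take_uniq ?enum_uniq // size_take_min -cardE.
  by rewrite cardsD (setIidPr AB); lia.
Qed.

Lemma exists_subgroup_of_units (F : finFieldType) t :
  (t %| #|{: {unit F}}|)%N -> exists H : {group {unit F}}, #|H| = t.
Proof.
have /cyclicP[x xE] := field_unit_group_cyclic [set: {unit F}]%G.
have ox : #[x]%g = #|{: {unit F}}| by rewrite /order -xE cardsT.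
rewrite -ox => tx; exists <[x ^+ (#[x]%g %/ t)]>%G.
have x0 : (0 < #[x]%g)%N := order_gt0 x.
have t0 : (0 < t)%N by exact: dvdn_gt0 tx.
rewrite -[#|_|]/(#[_]%g) orderXdiv; last by rewrite dvdn_div //.
by rewrite divnA // mulKn.
Qed.

Section LinesThroughCommonPoints.
Local Open Scope group_scope.
Variables (gT : finGroupType) (A B C : {set gT}).
Hypothesis ABC : forall a b, a \in A -> b \in B -> a * b^-1 \in C.

(** On the line of ordinate y outside B, the points to avoid are the set A and
    its companion C y, and A meets C y in as many points as there are a in A
    with a / y in C.  These incidences number |A| |C| over all y, of which the
    hypothesis assigns the maximal share |A| |B| to the y in B. *)
Lemma card_off_concurrent_lines :
  (#|[pred z : gT * gT |
       [&& z.1 \notin A, z.2 \notin B & (z.1 * z.2^-1)%g \notin C]]|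
     + (#|C| + #|A| + #|B|) * #|gT| = #|gT| ^ 2 + #|C| * (#|A| + #|B|))%N.
Proof.
set W := #|[pred z | _]|.
have WE : W = (\sum_(y in ~: B) #|~: (A :|: C :* y)%g|)%N.
  transitivity (\sum_x \sum_y
      [&& x \notin A, y \notin B & (x * y^-1)%g \notin C])%N.
    exact: (card_pairs (fun x y : gT =>
      [&& x \notin A, y \notin B & (x * y^-1)%g \notin C])).
  rewrite exchange_big [RHS]big_mkcond /=; apply: eq_bigr => y _.
  rewrite inE; case: (y \in B) => /=.
    by rewrite big1 // => x _; rewrite andbF.
  rewrite -sum1_card [RHS]big_mkcond; apply: eq_bigr => x _.
  by rewrite !inE mem_rcoset negb_or; case: ifP.
have incidences : (\sum_y #|(A :&: C :* y)%g| = #|A| * #|C|)%N.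
  transitivity (\sum_y \sum_(a in A) ((a * y^-1)%g \in C))%N.
    apply: eq_bigr => y _; rewrite -sum1_card big_mkcond [RHS]big_mkcond /=.
    apply: eq_bigr => a _; rewrite inE mem_rcoset.
    by case: (a \in A); case: (_ \in C).
  rewrite exchange_big /= -sum_nat_const; apply: eq_bigr => a _.
  rewrite (reindex_inj (inj_comp (mulIg a) invg_inj)) /=.
  rewrite (eq_bigr (fun y : gT => nat_of_bool (y \in C))) => [|y _].
    by rewrite -sum1_card [RHS]big_mkcond; apply: eq_bigr => y _; case: ifP.
  by rewrite invMg invgK mulKVg.
have inB : (\sum_(y in B) #|(A :&: C :* y)%g| = #|B| * #|A|)%N.
  rewrite -sum_nat_const; apply: eq_bigr => y yB; apply: eq_card => a.
  rewrite inE mem_rcoset andbC.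
  case: (boolP (a \in A)) => [aA|]; last by rewrite andbF.
  by rewrite (ABC aA yB).
have offB : (W + #|~: B| * (#|A| + #|C|) =
    #|~: B| * #|gT| + \sum_(y in ~: B) #|(A :&: C :* y)%g|)%N.
  rewrite WE -!sum_nat_const -!big_split /=; apply: eq_bigr => y _.
  rewrite -(cardsC (A :|: C :* y)) -(card_rcoset C y) -[in LHS]cardsUI.
  by rewrite addnCA addnA.
have : (\sum_y #|(A :&: C :* y)%g| =
    \sum_(y in B) #|(A :&: C :* y)%g| + \sum_(y in ~: B) #|(A :&: C :* y)%g|)%N.
  rewrite (bigID (mem B)) /=; congr (_ + _)%N.
  by apply: eq_bigl => y; rewrite inE.
rewrite incidences inB => split_sum.
have BN := cardsC B.
move: offB; rewrite -BN; nia.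
Qed.

End LinesThroughCommonPoints.

(** A and B are taken inside a subgroup of order t, which contains all the
    quotients, and C around it. *)
Lemma exists_concurrent_lines (F : finFieldType) a b c t :
  (b <= a)%N -> (a <= t)%N -> (t <= c)%N -> (c <= #|{: {unit F}}|)%N ->
  (t %| #|{: {unit F}}|)%N ->
  exists A B C : {set {unit F}}, [/\ #|A| = a, #|B| = b, #|C| = c &
    forall x y, x \in A -> y \in B -> (x * y^-1)%g \in C].
Proof.
move=> ba at_ tc cN /exists_subgroup_of_units[H Ht].
have [|A [_ AH Am]] := @exists_set_between _ set0 H a (sub0set _).
  by rewrite cards0 Ht.
have [|B [_ BH Bn]] := @exists_set_between _ set0 H b (sub0set _).
  by rewrite cards0 Ht (leq_trans ba).
have [|C [HC _ Cs]] := @exists_set_between _ H [set: {unit F}] c (subsetT _).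
  by rewrite Ht tc cardsT.
exists A, B, C; split => // x y xA yB; apply: (subsetP HC).
by apply: groupM; rewrite ?groupV; [exact: (subsetP AH)|exact: (subsetP BH)].
Qed.

(** * Convex hulls and linear functionals *)

From mathcomp Require Import all_classical all_reals all_analysis.
Import numFieldNormedType.Exports.
Local Open Scope classical_set_scope.

Section Convexity.
Variable R : realType.
Implicit Types (A B : set (plane R)) (p v : plane R).

Lemma convex_setP A : @convex_set R (plane R) A <->
  forall p v (t : R), A p -> A v -> 0 <= t <= 1 -> A (t *: p + (1 - t) *: v).
Proof.
split=> [cA p v t Ap Av /andP[t0 t1]|cA p v t].
  by have := cA p v (Itv01 t0 t1); rewrite !inE; apply.
by rewrite !inE => Ap Av; apply: (cA p v t%:num) => //; rewrite ge0 le1.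
Qed.

Lemma convex_hull_mix A p v (t : R) :
  convex_hull A p -> convex_hull A v -> 0 <= t <= 1 ->
  convex_hull A (t *: p + (1 - t) *: v).
Proof.
move=> Ap Av t01 M [cM AM] /=.
move/convex_setP: cM (cM) => cM' cM; apply: cM' => //.
  exact: Ap (conj cM AM).
exact: Av (conj cM AM).
Qed.

Definition bounded_by A (w : R * R) (k : R) :=
  forall p, A p -> w.1 * p.1 + w.2 * p.2 <= k.

Lemma bounded_by_hull A w k : bounded_by A w k -> bounded_by (convex_hull A) w k.
Proof.
move=> Ak; apply: smallest_sub => //; apply/convex_setP => -[p1 p2] [v1 v2] t.
move=> /= pk vk /andP[t0 t1]; rewrite /GRing.scale /=.
have := lerD (ler_wpM2l t0 pk) (ler_wpM2l (_ : 0 <= 1 - t) vk).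
by rewrite subr_ge0 t1 => /(_ isT); lra.
Qed.

Lemma bounded_by_segment0 v w k :
  0 <= k -> w.1 * v.1 + w.2 * v.2 <= k -> bounded_by (segment0 v) w k.
Proof.
by move=> k0 vk; apply: bounded_by_hull => p [->|->] //=; rewrite !mulr0 addr0.
Qed.

Lemma bounded_by_std_simplex w k :
  0 <= k -> w.1 <= k -> w.2 <= k -> bounded_by (std_simplex R) w k.
Proof.
move=> k0 w1 w2; apply: bounded_by_hull => p [->|[->|->]] /=;
  by rewrite ?mulr0 ?mulr1 ?addr0 ?add0r.
Qed.

Lemma bounded_by_add A B w k k' :
  bounded_by A w k -> bounded_by B w k' ->
  bounded_by (minkowski_add A B) w (k + k').
Proof.
move=> Ak Bk _ [p Ap [v Bv <-]] /=.
by rewrite !mulrDr addrACA; apply: lerD; [exact: Ak|exact: Bk].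
Qed.

Lemma bounded_by_dilate A w k d :
  bounded_by A w k -> bounded_by (dilate d A) w (k *+ d).
Proof.
move=> Ak _ [p Ap <-].
have -> : w.1 * (p *+ d).1 + w.2 * (p *+ d).2 = (w.1 * p.1 + w.2 * p.2) *+ d.
  by rewrite (raddfMn fst) (raddfMn snd) /= !mulrnAr -mulrnDl.
by rewrite lerMn2r Ak ?orbT.
Qed.

Lemma segment0_scale v (t : R) : 0 <= t <= 1 -> segment0 v (t *: v).
Proof.
move=> t01; rewrite -[t *: v]addr0 -(scaler0 _ (1 - t)).
by apply: convex_hull_mix => //; apply: sub_gen_smallest; [right|left].
Qed.

Lemma dilate_segment0_scale v d (t : R) :
  0 <= t <= d%:R -> dilate d (segment0 v) (t *: v).
Proof.
case: d => [|d] /andP[t0 td].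
  have -> : t = 0 by apply/eqP; rewrite eq_le t0 td.
  exists 0; last by rewrite scale0r.
  by rewrite -(scale0r v); apply: segment0_scale; rewrite lexx ler01.
exists ((t / d.+1%:R) *: v).
  by apply: segment0_scale; rewrite divr_ge0 //= ler_pdivrMr ?ltr0n // mul1r.
by rewrite -scaler_nat scalerA mulrCA divff ?mulr1 // pnatr_eq0.
Qed.

Lemma std_simplex_point (x y : R) :
  0 <= x -> 0 <= y -> x + y <= 1 -> std_simplex R (x, y).
Proof.
move=> x0 y0 xy1.
have S0 : std_simplex R (0, 0) by apply: sub_gen_smallest; left.
have S1 : std_simplex R (1, 0) by apply: sub_gen_smallest; right; left.
have S2 : std_simplex R (0, 1) by apply: sub_gen_smallest; right; right.
have [/eqP|xy] := eqVneq (x + y) 0.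
  by rewrite paddr_eq0 // => /andP[/eqP -> /eqP ->].
have xy0 : 0 < x + y by rewrite lt_neqAle eq_sym xy addr_ge0.
(* (x, y) lies between the origin and its projection from it to the long side *)
have t01 : 0 <= x / (x + y) <= 1.
  by rewrite (divr_ge0 x0 (ltW xy0)) ler_pdivrMr // mul1r lerDl.
have := convex_hull_mix (t := x + y) (convex_hull_mix S1 S2 t01) S0.
rewrite (ltW xy0) xy1 => /(_ isT).
congr (std_simplex R _); rewrite /GRing.scale /=; congr pair;
  by rewrite /= /GRing.scale /=; field.
Qed.

Lemma dilate_std_simplex_point d (x y : R) :
  0 <= x -> 0 <= y -> x + y <= d%:R -> dilate d (std_simplex R) (x, y).
Proof.
case: d => [|d] x0 y0 xyd.
  have : x + y == 0 by rewrite eq_le xyd addr_ge0.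
  rewrite paddr_eq0 // => /andP[/eqP -> /eqP ->].
  by exists (0, 0) => //; apply: std_simplex_point => //; rewrite addr0.
have d0 : 0 < d.+1%:R :> R by rewrite ltr0n.
exists (x / d.+1%:R, y / d.+1%:R).
  by apply: std_simplex_point; rewrite ?divr_ge0 // -mulrDl ler_pdivrMr // mul1r.
rewrite -scaler_nat; congr pair; rewrite /GRing.scale /=; field; exact: lt0r_neq0.
Qed.

Lemma minkowski_addP A B p v : A p -> B v -> minkowski_add A B (p + v).
Proof. by move=> Ap Bv; exists p => //; exists v. Qed.

End Convexity.

(** * The polygon Q *)

Section Polygon.
Variables (R : realType) (m n l s : nat).

Definition toric_polygon : set (plane R) :=
  minkowski_add (minkowski_add (minkowski_add (minkowski_add
      (dilate m (segment0 (1, 0))) (dilate n (segment0 (0, 1))))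
      (dilate l (segment0 ((1, 0) + (0, 1)))))
      (dilate s (segment0 ((1, 0) - (0, 1)))))
      (dilate (2 * l)%N (std_simplex R)).

(** The support function of a Minkowski sum is the sum of those of the summands;
    each ki dominates the maximum of w on one of them. *)
Lemma toric_polygon_bounded (w : R * R) (k1 k2 k3 k4 k5 N : nat) :
  [/\ w.1 <= k1%:R, w.2 <= k2%:R, w.1 + w.2 <= k3%:R & w.1 - w.2 <= k4%:R] ->
  w.1 <= k5%:R -> w.2 <= k5%:R ->
  (k1 * m + k2 * n + k3 * l + k4 * s + k5 * (2 * l) = N)%N ->
  bounded_by toric_polygon w N%:R.
Proof.
move=> [wk1 wk2 wk3 wk4] wk5 wk5' <-.
have natrE k d : (k * d)%:R = k%:R *+ d :> R by rewrite natrM mulr_natr.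
rewrite !natrD !natrE.
do !apply: bounded_by_add.
- by apply/bounded_by_dilate/bounded_by_segment0 => //=; rewrite mulr1 mulr0 addr0.
- by apply/bounded_by_dilate/bounded_by_segment0 => //=; rewrite mulr1 mulr0 add0r.
- by apply/bounded_by_dilate/bounded_by_segment0 => //=; rewrite addr0 add0r !mulr1.
- by apply/bounded_by_dilate/bounded_by_segment0 => //=;
    rewrite subr0 sub0r mulr1 mulrN1.
- exact/bounded_by_dilate/bounded_by_std_simplex.
Qed.

Lemma toric_polygon_ineqs (p : plane R) : toric_polygon p ->
  [/\ 0 <= p.1, - s%:R <= p.2, 0 <= p.1 + p.2 <= (m + n + 4 * l)%:R,
      p.1 - p.2 <= (m + 2 * l + 2 * s)%:R & p.2 - p.1 <= (n + 2 * l)%:R].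
Proof.
case: p => x y Qp /=.
have sx : -1 * x + 0 * y <= 0%:R.
  by apply: (@toric_polygon_bounded (-1, 0) 0 0 0 0 0 0) Qp;
    [split; rewrite /=; lra|rewrite /=; lra..|lia].
have sy : 0 * x + -1 * y <= s%:R.
  by apply: (@toric_polygon_bounded (0, -1) 0 0 0 1 0 s) Qp;
    [split; rewrite /=; lra|rewrite /=; lra..|lia].
have sN : -1 * x + -1 * y <= 0%:R.
  by apply: (@toric_polygon_bounded (-1, -1) 0 0 0 0 0 0) Qp;
    [split; rewrite /=; lra|rewrite /=; lra..|lia].
have sD : 1 * x + 1 * y <= (m + n + 4 * l)%:R.
  by apply: (@toric_polygon_bounded (1, 1) 1 1 2 0 1 _) Qp;
    [split; rewrite /=; lra|rewrite /=; lra..|lia].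
have sB : 1 * x + -1 * y <= (m + 2 * l + 2 * s)%:R.
  by apply: (@toric_polygon_bounded (1, -1) 1 0 0 2 1 _) Qp;
    [split; rewrite /=; lra|rewrite /=; lra..|lia].
have sC : -1 * x + 1 * y <= (n + 2 * l)%:R.
  by apply: (@toric_polygon_bounded (-1, 1) 0 1 0 0 1 _) Qp;
    [split; rewrite /=; lra|rewrite /=; lra..|lia].
rewrite !mul1r !mulN1r !mul0r ?addr0 ?add0r in sx sy sN sD sB sC.
split.
- by rewrite -oppr_le0.
- by rewrite lerNl.
- by rewrite sD andbT -oppr_le0 opprD.
- exact: sB.
- by rewrite addrC.
Qed.

(** The rectangle m [0, e1] + n [0, e2] + 2l ([0, e1] + [0, e2]) is contained in
    the sum of the other summands than s [0, e1 - e2]: the square of side 2l lies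
    in l [0, e1 + e2] + 2l Delta, because a point of the square above the diagonal
    enters 2l Delta when it moves along - (e1 + e2). *)
Lemma toric_polygon_mem (a b c : R) :
  0 <= a <= (m + 2 * l)%:R -> 0 <= b <= (n + 2 * l)%:R -> 0 <= c <= s%:R ->
  toric_polygon (a + c, b - c).
Proof.
rewrite (natrD _ m) (natrD _ n) (natrM _ 2) => /andP[a0 am] /andP[b0 bn] c0.
have split_coord (x : R) k : 0 <= x -> x <= k%:R + 2 * l%:R ->
    exists x1 x2, [/\ x = x1 + x2, 0 <= x1 <= k%:R & 0 <= x2 <= 2 * l%:R].
  move=> x0 xk; have k0 : 0 <= k%:R :> R by [].
  have l0 : 0 <= l%:R :> R by [].
  have [xk'|xk'] := leP x k%:R.
    by exists x, 0; split; [lra|apply/andP; split; lra..].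
  by exists k%:R, (x - k%:R); split; [lra|apply/andP; split; lra..].
have [a1 [a2 [-> a1P /andP[a20 a2l]]]] := split_coord _ _ a0 am.
have [b1 [b2 [-> b1P /andP[b20 b2l]]]] := split_coord _ _ b0 bn.
(* d (e1 + e2) is the displacement along the diagonal *)
have [d [d0 da db dl dab]] : exists d : R,
    [/\ 0 <= d <= l%:R, d <= a2, d <= b2, d <= l%:R &
        a2 + b2 - 2 * d <= 2 * l%:R].
  have [ab|ab] := leP (a2 + b2) (2 * l%:R).
    by exists 0; split; rewrite ?lexx //; lra.
  by exists ((a2 + b2) / 2 - l%:R); split; try (apply/andP; split); lra.
have -> : (a1 + a2 + c, b1 + b2 - c) = a1 *: (1, 0) + b1 *: (0, 1)
    + d *: ((1, 0) + (0, 1)) + c *: ((1, 0) - (0, 1))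
    + (a2 - d, b2 - d) :> plane R.
  by apply: injective_projections;
    rewrite /= /GRing.scale /= ?(mulr1, mulr0) /=; ring.
do !apply: minkowski_addP; try exact: dilate_segment0_scale.
by apply: dilate_std_simplex_point; rewrite ?natrM; lra.
Qed.

End Polygon.

(** * The Minkowski length of Q *)

Section MinkowskiLength.
Variable R : realType.

Lemma minkowski_sum_mem (I : finType) (P : I -> set (plane R)) (p : I -> plane R) :
  (forall i, P i (p i)) -> (\big[@minkowski_add R/[set 0]]_i P i) (\sum_i p i).
Proof.
move=> Pp; exact: (@big_ind2 _ _ (fun (A : set (plane R)) x => A x) _ _ _ _
  (erefl _) (fun A x B y => @minkowski_addP R A B x y)).
Qed.

Lemma minkowski_sum_memP (I : finType) (P : I -> set (plane R)) z :
  (\big[@minkowski_add R/[set 0]]_i P i) z ->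
  exists2 p : I -> plane R, (forall i, P i (p i)) & z = \sum_i p i.
Proof.
suff gen (r : seq I) : uniq r ->
    forall z, (\big[@minkowski_add R/[set 0]]_(i <- r) P i) z ->
    exists2 p : I -> plane R,
      (forall i, i \in r -> P i (p i)) & z = \sum_(i <- r) p i.
  move=> /(gen _ (index_enum_uniq I)) [p Pp ->].
  by exists p => // i; apply: Pp; rewrite mem_index_enum.
elim: r => [_ {}z|i r IH /= /andP[ir ur] {}z].
  by rewrite !big_nil => ->; exists (fun=> 0); rewrite ?big_nil.
rewrite big_cons => -[x Px [_ /(IH ur)[p Pp ->] <-]].
exists (fun j => if j == i then x else p j) => [j|].
  by rewrite inE; case: eqP => [-> _|_ /Pp].
rewrite big_cons eqxx; congr (_ + _); apply: eq_big_seq => j jr.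
by case: eqP => // ji; rewrite -ji jr in ir.
Qed.

(** The triple bounds max (x + y) - min x - min y below by 1.  If a and b are two
    lattice points and b is not to the left of a, then (a, a, b) serves when b is
    not below a, and (a, b, a) when it is. *)
Lemma lattice_width (P : set (plane R)) : lattice_polytope P -> nontrivial P ->
  exists p : plane R * plane R * plane R,
    [/\ P p.1.1, P p.1.2, P p.2 & 1 <= p.2.1 + p.2.2 - p.1.1.1 - p.1.2.2].
Proof.
move=> [A [_ [a0 Aa0] ->]] [x [y [Px Py xy]]].
have AP a : A a -> convex_hull (lattice_point R @` A) (lattice_point R a).
  by move=> Aa; apply: sub_gen_smallest; exists a.
have [a [b [Aa Ab ab]]] : exists a b, [/\ A a, A b & a != b].
  apply: contrapT => /forallNP NA; apply: xy.
  have sub : convex_hull (lattice_point R @` A) `<=` [set lattice_point R a0].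
    apply: smallest_sub.
      apply/convex_setP => p v t -> -> _ /=.
      by rewrite -scalerDl addrC subrK scale1r.
    move=> _ [b Ab <-] /=; congr (lattice_point R _); apply: contrapT => ba.
    by apply: (NA b); exists a0; split => //; apply/eqP.
  by rewrite (sub _ Px) (sub _ Py).
suff [u [v [w [Au Av Aw uvw]]]] : exists u v w : int * int,
    [/\ A u, A v, A w & 1 <= w.1 + w.2 - u.1 - v.2].
  exists (lattice_point R u, lattice_point R v, lattice_point R w).
  split; rewrite /=; [exact: AP..|].
  by rewrite -intrD -!intrB -[1]/(1%:~R) ler_int.
wlog ab1 : a b Aa Ab ab / a.1 <= b.1.
  by move=> wl; have [/wl|/ltW/wl] := leP a.1 b.1; apply => //; rewrite eq_sym.
have ne : a.1 != b.1 \/ a.2 != b.2.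
  move: ab; rewrite [a]surjective_pairing [b]surjective_pairing xpair_eqE.
  by rewrite negb_and => /orP.
have [ab2|ab2] := leP a.2 b.2.
  by exists a, a, b; split => //; lia.
by exists a, b, a; split => //; lia.
Qed.

(** The maximum of x + y minus the minima of x and y is additive under Minkowski
    sums and at least 1 on each summand. *)
Lemma minkowski_count_bound (Q : set (plane R)) k (x0 y0 c : R) :
  (forall p, Q p -> [/\ x0 <= p.1, y0 <= p.2 & p.1 + p.2 <= c]) ->
  contains_minkowski_sum Q k -> k%:R <= c - x0 - y0.
Proof.
move=> QB [P [Plat PQ]].
have [f fP] := choice (fun i => lattice_width (Plat i).1 (Plat i).2).
have inQ (p : 'I_k -> plane R) : (forall i, P i (p i)) -> Q (\sum_i p i).
  by move=> Pp; apply/PQ/minkowski_sum_mem.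
have [x0u _ _] := QB _ (inQ (fun i => (f i).1.1) (fun i => ltac:(by case: (fP i)))).
have [_ y0v _] := QB _ (inQ (fun i => (f i).1.2) (fun i => ltac:(by case: (fP i)))).
have [_ _ wc] := QB _ (inQ (fun i => (f i).2) (fun i => ltac:(by case: (fP i)))).
have : \sum_(i < k) 1 <=
    \sum_i ((f i).2.1 + (f i).2.2 - (f i).1.1.1 - (f i).1.2.2).
  by apply: ler_sum => i _; have [] := fP i.
rewrite !sumrB big_split /= sumr_const card_ord.
rewrite (raddf_sum fst) /= in x0u; rewrite (raddf_sum snd) /= in y0v.
rewrite (raddf_sum fst) (raddf_sum snd) /= in wc.
lra.
Qed.

End MinkowskiLength.

Lemma maximum_eq (A : set nat) N :
  A N -> (forall k, A k -> (k <= N)%N) -> maximum A = N.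
Proof.
move=> AN AleN; apply: xget_unique => [|k [Ak ubk]].
  by split=> // k /AleN; rewrite leEnat.
by apply/eqP; rewrite eqn_leq AleN //= -leEnat; exact: ubk.
Qed.

Lemma minimum_eq (A : set nat) N :
  A N -> (forall k, A k -> (N <= k)%N) -> minimum A = N.
Proof.
move=> AN NleA; apply: xget_unique => [|k [Ak lbk]].
  by split=> // k /NleA; rewrite leEnat.
by apply/eqP; rewrite eqn_leq NleA // andbT -leEnat; exact: lbk.
Qed.

Section Length.
Variable R : realType.

Lemma segment0P (v z : plane R) : segment0 v z ->
  exists2 t : R, 0 <= t <= 1 & z = t *: v.
Proof.
suff: segment0 v `<=` [set z | exists2 t : R, 0 <= t <= 1 & z = t *: v] by apply.
apply: smallest_sub => [|{}z [->|->]] /=.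
- apply/convex_setP => _ _ t [t1 t1P ->] [t2 t2P ->] tP /=.
  exists (t * t1 + (1 - t) * t2); last first.
    by rewrite [RHS]scalerDl !scalerA.
  by apply/andP; split; nra.
- by exists 0; rewrite ?lexx ?ler01 ?scale0r.
- by exists 1; rewrite ?lexx ?ler01 ?scale1r.
Qed.

Lemma lattice_polytope_segment0 (a : int * int) :
  lattice_polytope (segment0 (lattice_point R a)).
Proof.
exists [set 0; a]; split; [exact: finite_set2|by exists 0; left|].
by rewrite image_setU !image_set1.
Qed.

Lemma nontrivial_segment0 (a : int * int) : a != 0 ->
  nontrivial (segment0 (lattice_point R a)).
Proof.
move=> a0; exists 0, (lattice_point R a).
split; [by apply: sub_gen_smallest; left|by apply: sub_gen_smallest; right|].
move=> [/esym/eqP + /esym/eqP]; rewrite !intr_eq0 => a1 a2.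
by move: a0; rewrite [a]surjective_pairing xpair_eqE a1 a2.
Qed.

Variables (m n l s : nat).
Local Notation Q := (@toric_polygon R m n l s).

Lemma toric_polygon_contains_sum :
  contains_minkowski_sum Q ((m + 2 * l) + ((n + 2 * l) + s)).
Proof.
pose v (i : 'I_((m + 2 * l) + ((n + 2 * l) + s))) : int * int :=
  match fintype.split i with
  | inl _ => (1, 0)
  | inr j => if fintype.split j is inl _ then (0, 1) else (1, -1)
  end.
exists (fun i => segment0 (lattice_point R (v i))).
split=> [i|_ /minkowski_sum_memP[p pP ->]].
  split; [exact: lattice_polytope_segment0|apply: nontrivial_segment0].
  by rewrite /v; case: fintype.splitP => // j _; case: fintype.splitP.
have /choice[t tP] : forall i, exists t : R,
    0 <= t <= 1 /\ p i = t *: lattice_point R (v i).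
  by move=> i; have [t] := segment0P (pP i); exists t.
rewrite (eq_bigr (fun i => t i *: lattice_point R (v i))) => [|i _]; last first.
  by case: (tP i).
have sumP (I : finType) (f : I -> 'I_((m + 2 * l) + ((n + 2 * l) + s))) :
    0 <= \sum_i t (f i) <= #|I|%:R.
  apply/andP; split; first by apply: sumr_ge0 => i _; have [/andP[]] := tP (f i).
  rewrite -sum1_card natr_sum; apply: ler_sum => i _.
  by have [/andP[]] := tP (f i).
have vl i : v (lshift _ i) = (1, 0) by rewrite /v (unsplitK (inl i)).
have vrl i : v (rshift _ (lshift _ i)) = (0, 1).
  by rewrite /v (unsplitK (inr _)) (unsplitK (inl i)).
have vrr i : v (rshift _ (rshift _ i)) = (1, -1).
  by rewrite /v (unsplitK (inr _)) (unsplitK (inr i)).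
have -> : \sum_i t i *: lattice_point R (v i) =
    (\sum_i t (lshift _ i)) *: ((1, 0) : plane R)
    + ((\sum_i t (rshift _ (lshift _ i))) *: ((0, 1) : plane R)
    + (\sum_i t (rshift _ (rshift _ i))) *: ((1, -1) : plane R)).
  rewrite (@big_split_ord _ _ _ (m + 2 * l) (n + 2 * l + s)) /=.
  rewrite (@big_split_ord _ _ _ (n + 2 * l) s) /= !scaler_suml.
  by congr (_ + (_ + _)); apply: eq_bigr => i _; rewrite ?vl ?vrl ?vrr.
have aP := sumP _ (@lshift (m + 2 * l) (n + 2 * l + s)).
have bP := sumP _ (fun i : 'I_(n + 2 * l) => rshift (m + 2 * l) (lshift s i)).
have cP := sumP _ (fun i : 'I_s => rshift (m + 2 * l) (rshift (n + 2 * l) i)).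
rewrite !card_ord in aP bP cP.
have := toric_polygon_mem aP bP cP.
congr (toric_polygon _ _ _ _ _).
by apply: injective_projections;
  rewrite /= /GRing.scale /= ?(mulr1, mulr0); ring.
Qed.

Lemma minkowski_length_toric_polygon :
  minkowski_length Q = (s + (m + 2 * l) + (n + 2 * l))%N.
Proof.
apply: maximum_eq => [|k].
  by rewrite -addnA addnC -addnA; exact: toric_polygon_contains_sum.
move=> /(minkowski_count_bound (x0 := 0) (y0 := - s%:R)
  (c := (m + n + 4 * l)%:R)).
rewrite subr0 opprK -natrD ler_nat => kL; apply: leq_trans (kL _) _; last by lia.
by move=> p /toric_polygon_ineqs[? ? /andP[_ ?] _ _].
Qed.

End Length.

(** * Codewords as sums of monomials *)

Section Laurent.
Variables (F : finFieldType) (R : realType).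
Implicit Types (Q : set (plane R)) (f : laurent F).

Lemma laurent_spaceP Q f :
  laurent_space Q f <-> forall a, f a != 0 -> Q (lattice_point R a).
Proof.
have monoE a b : laurent_monomial F a b = (b == a)%:R.
  by rewrite fsfunE inE; case: (b == a).
split=> [[r [c [rQ fE]]] b|fQ].
  rewrite fE => fb; apply: contrapT => Qb; move/eqP: fb; apply.
  rewrite big_seq big1 // => a /rQ Qa; rewrite monoE.
  by case: eqP => [ba|_]; [rewrite ba in Qb|rewrite mulr0].
exists (finsupp f), f; split=> [a|b]; first by rewrite mem_finsupp => /fQ.
have [bf|bf] := boolP (b \in finsupp f).
  rewrite (bigD1_seq b) ?fset_uniq //= monoE eqxx mulr1 big1 ?addr0 // => a ab.
  by rewrite monoE eq_sym (negPf ab) mulr0.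
rewrite fsfun_dflt // big_seq big1 // => a af; rewrite monoE.
by case: eqP => [ba|_]; [rewrite -ba (negPf bf) in af|rewrite mulr0].
Qed.

Lemma laurent_eval_sub f (r : seq (int * int)) g :
  uniq r -> {subset finsupp f <= r} ->
  laurent_eval f g = \sum_(a <- r) f a * (val g.1 ^ a.1 * val g.2 ^ a.2).
Proof.
move=> ur fr; rewrite (bigID (fun a => a \in finsupp f)) /=.
rewrite [X in _ + X]big1 ?addr0 => [|a /fsfun_dflt -> //]; last by rewrite mul0r.
rewrite -big_filter; apply: perm_big; apply: uniq_perm;
  rewrite ?filter_uniq ?fset_uniq // => a.
rewrite mem_filter andbC.
by case: (boolP (a \in finsupp f)) => [/fr ->|]; rewrite ?andbF.
Qed.

(** The exponents e i may coincide, so the coefficients are first collected. *)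
Lemma toric_code_span (I : finType) (c : I -> F) (e : I -> int * int) Q :
  (forall i, Q (lattice_point R (e i))) ->
  toric_code F Q [ffun g =>
    \sum_i c i * (val g.1 ^ (e i).1 * val g.2 ^ (e i).2)].
Proof.
move=> eQ.
pose r := undup (codom e).
pose f : laurent F := [fsfun b in seq_fset tt r => \sum_(i | e i == b) c i].
have fE b : f b = \sum_(i | e i == b) c i.
  rewrite fsfunE seq_fsetE mem_undup; case: ifPn => // br.
  rewrite big_pred0 // => i.
  by apply/eqP => ib; rewrite -ib codom_f in br.
exists f.
  apply/laurent_spaceP => a; rewrite fE => fa.
  have [i /eqP <-|noi] := pickP (fun i => e i == a); first exact: eQ.
  by rewrite big_pred0 ?eqxx in fa.
apply/ffunP => g; rewrite !ffunE (@laurent_eval_sub _ r) ?undup_uniq //; last first.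
  by move=> a; rewrite mem_finsupp fsfunE seq_fsetE; case: ifP; rewrite ?eqxx.
under eq_bigr do rewrite fE mulr_suml.
rewrite (exchange_big_dep xpredT) //=; apply: eq_bigr => i _.
rewrite big_mkcond (bigD1_seq (e i)) ?undup_uniq ?mem_undup ?codom_f //= eqxx.
by rewrite big1 ?addr0 // => a /negPf; rewrite eq_sym => ->.
Qed.

End Laurent.

(** * The weights of codewords *)

Section Weights.
Variables (F : finFieldType) (R : realType) (m n l s : nat).
Local Notation U := {unit F}.
Local Notation Q := (@toric_polygon R m n l s).

Lemma lattice_point_toric_polygon (a : int * int) : Q (lattice_point R a) ->
  [/\ 0 <= a.1, 0 <= a.2 + s%:Z, 0 <= a.1 + a.2 <= (m + n + 4 * l)%:Z,
      a.1 - a.2 <= (m + 2 * l + 2 * s)%:Z & a.2 - a.1 <= (n + 2 * l)%:Z].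
Proof.
move=> /toric_polygon_ineqs /= [h1 h2 /andP[h3 h4] h5 h6].
split; [| |apply/andP; split| |];
  rewrite -(ler_int R) ?(intrB, intrD) -?pmulrn //.
by rewrite -lerBlDr sub0r.
Qed.

(** Multiplying by y^s moves the exponents of f to naturals and keeps its zeros in
    the torus, so the bound on zeros applies. *)
Lemma hamming_weight_ge (w : {ffun U * U -> F}) :
  (s * ((m + 2 * l) + (n + 2 * l)) <= #|{: U}|)%N ->
  toric_code F Q w -> w <> 0 ->
  (#|{: U}| ^ 2 + s * ((m + 2 * l) + (n + 2 * l))
    <= hamming_weight w + (s + (m + 2 * l) + (n + 2 * l)) * #|{: U}|)%N.
Proof.
move=> sU [f /laurent_spaceP fQ <-] w0.
pose e1 (a : finsupp f) := absz (val a).1.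
pose e2 (a : finsupp f) := absz ((val a).2 + s%:Z).
have eP (a : finsupp f) :
    [/\ (e1 a)%:Z = (val a).1, (e2 a)%:Z = (val a).2 + s%:Z,
    (s <= e1 a + e2 a)%N, (e1 a + e2 a <= s + (m + 2 * l) + (n + 2 * l))%N &
    (e1 a <= e2 a + (s + (m + 2 * l)))%N
      /\ (e2 a <= e1 a + (s + (n + 2 * l)))%N].
  have /fQ/lattice_point_toric_polygon[] : f (val a) != 0.
    by rewrite -mem_finsupp; exact: valP.
  by rewrite /e1 /e2; move: (val a) => [x y] /=; split; [| | | |split]; lia.
have evE g : \sum_a f (val a) * (val g.1 ^+ e1 a * val g.2 ^+ e2 a)
    = laurent_eval f g * val g.2 ^+ s.
  rewrite /laurent_eval big_seq_fsetE mulr_suml; apply: eq_bigr => a _.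
  have [E1 E2 _ _ _] := eP a.
  by rewrite !exprnP E1 E2 expfzDr ?unit_val_neq0 // !mulrA.
have [g g0] : exists g, laurent_eval f g != 0.
  apply: contrapT => /forallNP f0; apply: w0; apply/ffunP => g; rewrite !ffunE.
  by have /negP/negPn/eqP := f0 g.
have := @torus_zeros_bound F _ (fun a => f (val a)) e1 e2
  s (m + 2 * l) (n + 2 * l)
  (fun a => ltac:(by case: (eP a))) (fun a => ltac:(by case: (eP a)))
  (fun a => ltac:(by case: (eP a) => ? ? ? ? []))
  (fun a => ltac:(by case: (eP a) => ? ? ? ? [])) g.
rewrite evE mulf_neq0 ?expf_neq0 ?unit_val_neq0 // => /(_ isT sU).
rewrite (eq_card (B := [predC [pred g | [ffun g => laurent_eval f g] g != 0]])).
  have := cardC [pred g | [ffun g => laurent_eval f g] g != 0].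
  rewrite card_prod mulnn /hamming_weight => <- zeros_le.
  by rewrite -addnA leq_add2l.
move=> z; rewrite !inE evE mulf_eq0 expf_eq0 (negPf (unit_val_neq0 _)).
by rewrite andbF orbF negbK ffunE.
Qed.

Definition split_poly_over (A : {set U}) : {poly F} :=
  \prod_(a <- [seq val u | u <- enum A]) ('X - a%:P).

Lemma size_split_poly_over A : size (split_poly_over A) = #|A|.+1.
Proof. by rewrite size_prod_XsubC size_map -cardE. Qed.

Lemma root_split_poly_over A (u : U) :
  ((split_poly_over A).[val u] == 0) = (u \in A).
Proof.
by rewrite -[LHS]/(root _ _) root_prod_XsubC mem_map ?mem_enum //; exact: val_inj.
Qed.

(** The Newton polygon of the product is contained in
    (m + 2l) [0, e1] + (n + 2l) [0, e2] + s [0, e1 - e2], hence in Q. *)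
Lemma toric_code_product (P1 P2 P3 : {poly F}) :
  (size P1 <= (m + 2 * l).+1)%N -> (size P2 <= (n + 2 * l).+1)%N ->
  (size P3 <= s.+1)%N ->
  toric_code F Q [ffun g : U * U =>
    P1.[val g.1] * P2.[val g.2] * P3.[val g.1 / val g.2]].
Proof.
move=> s1 s2 s3.
pose c (i : 'I_(m + 2 * l).+1 * 'I_(n + 2 * l).+1 * 'I_s.+1) :=
  P1`_(i.1.1) * P2`_(i.1.2) * P3`_(i.2).
pose e (i : 'I_(m + 2 * l).+1 * 'I_(n + 2 * l).+1 * 'I_s.+1) : int * int :=
  (i.1.1%:Z + i.2%:Z, i.1.2%:Z - i.2%:Z).
have eQ i : Q (lattice_point R (e i)).
  have nat_itv N (k : 'I_N.+1) : 0 <= (k%:R : R) <= N%:R.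
    by rewrite ler0n ler_nat leq_ord.
  have := toric_polygon_mem (nat_itv _ i.1.1) (nat_itv _ i.1.2) (nat_itv _ i.2).
  by rewrite /lattice_point /= intrD intrB.
have := toric_code_span c eQ; congr (toric_code F Q _).
apply/ffunP => g; rewrite !ffunE.
rewrite (horner_coef_wide _ s1) (horner_coef_wide _ s2) (horner_coef_wide _ s3).
rewrite big_distrlr /= pair_bigA /= big_distrlr pair_bigA /=.
apply: eq_bigr => i _; rewrite /c /e /=.
rewrite !expfzDr -?invr_expz; try exact: unit_val_neq0.
rewrite exprMn exprVn !exprnP.
by move: (_ ^-1) (_ ^ i.1.1) (_ ^ i.2) (_ ^ i.1.2) => y1 x1 x2 y2; ring.
Qed.

(** The product of three split polynomials whose root sets are concurrent.  It is
    nonzero because its weight is (N - s) (N - (m + 2l) - (n + 2l)) for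
    N = #|U|. *)
Lemma exists_light_codeword t :
  (n + 2 * l <= m + 2 * l)%N -> (m + 2 * l <= t <= s)%N -> (t %| #|{: U}|)%N ->
  (s + (m + 2 * l) < #|{: U}|)%N ->
  exists w, [/\ toric_code F Q w, w <> 0 &
   (hamming_weight w + (s + (m + 2 * l) + (n + 2 * l)) * #|{: U}| =
    #|{: U}| ^ 2 + s * ((m + 2 * l) + (n + 2 * l)))%N].
Proof.
move=> nm /andP[mt ts] tN smN.
have sN : (s <= #|{: U}|)%N by apply: leq_trans (ltnW smN); rewrite leq_addr.
have [A [B [C [Am Bn Cs ABC]]]] := exists_concurrent_lines nm mt ts sN tN.
pose w : {ffun U * U -> F} := [ffun g : U * U =>
  (split_poly_over A).[val g.1] * (split_poly_over B).[val g.2]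
  * (split_poly_over C).[val g.1 / val g.2]].
have wW : hamming_weight w = #|[pred z : U * U |
    [&& z.1 \notin A, z.2 \notin B & (z.1 * z.2^-1)%g \notin C]]|.
  apply: eq_card => z; rewrite !inE ffunE !mulf_eq0 !negb_or.
  rewrite -[val z.1 / val z.2]/(val (z.1 * z.2^-1)%g).
  by rewrite !root_split_poly_over andbA.
have := card_off_concurrent_lines ABC; rewrite -wW Am Bn Cs => weight_eq.
exists w; split => //.
  by apply: toric_code_product; rewrite size_split_poly_over ?Am ?Bn ?Cs.
move=> w0; move: weight_eq; rewrite /hamming_weight eq_card0 => [|z]; last first.
  by rewrite !inE w0 ffunE eqxx.
move: smN (leq_trans mt ts) nm; clear.
by move: #|{: U}| (m + 2 * l)%N (n + 2 * l)%N => N a b; nia.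
Qed.
End Weights.

Theorem corollary4p9 (R : realType) (F : finFieldType) (q : nat)
    (hq : #|F| = q) (m n l s : nat) :
  let e1 : plane R := (1, 0) in
  let e2 : plane R := (0, 1) in
  let Q : set (plane R) :=
    minkowski_add (minkowski_add (minkowski_add (minkowski_add
      (dilate m (segment0 e1)) (dilate n (segment0 e2)))
      (dilate l (segment0 (e1 + e2)))) (dilate s (segment0 (e1 - e2))))
      (dilate (2 * l)%N (std_simplex R)) in
  let M : R := Num.max (2 * area Q - 1) 6 in
  minkowski_add [set e2 *+ s] Q `<=` `[0, q%:R - 2] `*` `[0, q%:R - 2] ->
  (0 <= n + 2 * l <= m + 2 * l)%N -> (m + 2 * l <= s)%N ->
  (exists t : nat, (m + 2 * l <= t <= s)%N /\ (t %| q - 1)%N) ->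
  q%:R - 1 - M * Num.sqrt q%:R >
    (s * (2 * l + m) + s * (2 * l + n) + (2 * l + m) * (2 * l + n))%N%:R ->
  (min_distance (toric_code F Q))%:Z =
    (q%:Z - 1) ^+ 2 - (minkowski_length Q)%:Z * (q%:Z - 1)
    + s%:Z * (m%:Z + n%:Z + 4 * l%:Z).
Proof.
move=> e1 e2 Q M box nm _ [t [mts tq]] q_large.
have QE : Q = @toric_polygon R m n l s by [].
have Nq : (#|{: {unit F}}|.+1 = q)%N.
  rewrite -cardsT finalg.card_finField_unit prednK ?hq //.
  by rewrite -hq; apply/card_gt0P; exists 0.
have sU : (s * ((m + 2 * l) + (n + 2 * l)) <= #|{: {unit F}}|)%N.
  have M0 : 0 <= M * Num.sqrt q%:R.
    by rewrite mulr_ge0 ?sqrtr_ge0 // le_max ler0n orbT.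
  have : (s * (2 * l + m) + s * (2 * l + n) + (2 * l + m) * (2 * l + n))%:R
      <= (#|{: {unit F}}|%:R : R).
    rewrite -[in X in X - 1 - _]Nq -natr1 addrK in q_large.
    by apply: ltW; apply: lt_le_trans q_large _; rewrite gerBl.
  rewrite ler_nat; apply: leq_trans.
  by rewrite mulnDr ![(2 * l + _)%N]addnC leq_addr.
(* the point (m + 2l) e1 + s (e1 - e2) of Q, moved up by s, lies in the box *)
have smU : (s + (m + 2 * l) < #|{: {unit F}}|)%N.
  have corner : Q ((m + 2 * l)%:R + s%:R, 0 - s%:R).
    by rewrite QE; apply: toric_polygon_mem; rewrite ?lexx ?ler0n.
  have := box (e2 *+ s + ((m + 2 * l)%:R + s%:R, 0 - s%:R)).
  move=> /(_ (minkowski_addP (erefl _) corner))[+ _].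
  rewrite /= in_itv /= => /andP[_].
  by rewrite (raddfMn fst) /= mul0rn add0r lerBrDr -!natrD ler_nat -Nq; lia.
have tU : (t %| #|{: {unit F}}|)%N by move: tq; rewrite -Nq subn1.
have [w [Cw w0 weight_w]] := @exists_light_codeword F R m n l s t nm mts tU smU.
have -> : min_distance (toric_code F Q) = hamming_weight w.
  apply: minimum_eq; first by exists w.
  move=> _ [w' [Cw' w'0] <-].
  by have := hamming_weight_ge sU Cw' w'0; rewrite -weight_w leq_add2r.
rewrite QE minkowski_length_toric_polygon.
have -> : q%:Z - 1 = #|{: {unit F}}|%:Z by rewrite -Nq; lia.
by move: weight_w => /(congr1 Posz); rewrite -mulnn expr2; lia.
Qed.
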